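(* Let $\Gamma$ be a finitely generated group with Property FM or Property FW. Then any action of $\Gamma$ on $\mathbf{Z}$ by permutations of bounded displacement factors through a finite group.
   Context: A permutation $\sigma$ of $\mathbf{Z}$ has bounded displacement if $\sup_{k\in\mathbf{Z}}|\sigma(k)-k|<\infty$; an action is by permutations of bounded displacement if each group element acts by such a permutation (with a bound that may depend on the element). $\Gamma$ is a discrete group. If $\Gamma$ acts on a set $X$, a subset $M\subset X$ is commensurated if the symmetric difference $M\bigtriangleup gM$ is finite for every $g\in\Gamma$; it is transfixed if there is a $\Gamma$-invariant subset $N\subset X$ with $M\bigtriangleup N$ finite. A mean on $X$ is a finitely additive probability measure defined on all subsets of $X$. $\Gamma$ has Property FW if for every $\Gamma$-set $X$, every commensurated subset of $X$ is transfixed. $\Gamma$ has Property FM if every $\Gamma$-set with a $\Gamma$-invariant mean on all its subsets has a finite $\Gamma$-orbit. *)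

(* Defs.v *)
From HB Require Import structures.
From mathcomp Require Import all_boot all_order all_algebra fingroup.
From mathcomp Require Import all_classical all_reals.
Set Implicit Arguments.
Unset Strict Implicit.
Unset Printing Implicit Defensive.
Import Order.TTheory GRing.Theory Num.Theory.

Local Open Scope classical_set_scope.
Local Open Scope ring_scope.

(* Groups are abstract, possibly infinite [groupType]s; the actions of
   [mathcomp.fingroup.action] are right actions of finite groups only. *)
Record leftAction (G : groupType) (X : Type) := LeftAction {
  act :> G -> X -> X;
  act1 : forall x, act 1%g x = x;
  actM : forall g h x, act (g * h)%g x = act g (act h x)
}.

Definition finitely_generated (G : groupType) : Prop :=
  exists s : seq G, forall S : {pred G},
    group_closed S -> {subset s <= S} -> forall g, g \in S.

Definition commensurated (G : groupType) (X : Type) (a : leftAction G X)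
    (M : set X) : Prop :=
  forall g, finite_set (M `+` (a g @` M)).

Definition invariant_set (G : groupType) (X : Type) (a : leftAction G X)
    (N : set X) : Prop :=
  forall g, a g @` N = N.

Definition transfixed (G : groupType) (X : Type) (a : leftAction G X)
    (M : set X) : Prop :=
  exists N : set X, invariant_set a N /\ finite_set (M `+` N).

Definition property_FW (G : groupType) : Prop :=
  forall (X : Type) (a : leftAction G X) (M : set X),
    commensurated a M -> transfixed a M.

Record mean (R : realType) (X : Type) := Mean {
  mean_val :> set X -> R;
  mean_ge0 : forall A, 0 <= mean_val A;
  mean_setT : mean_val setT = 1;
  mean_setU : forall A B, A `&` B = set0 ->
    mean_val (A `|` B) = mean_val A + mean_val B
}.

Definition invariant_mean (R : realType) (G : groupType) (X : Type)
    (a : leftAction G X) (m : mean R X) : Prop :=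
  forall g (A : set X), m (a g @` A) = m A.

Definition action_orbit (G : groupType) (X : Type) (a : leftAction G X)
    (x : X) : set X :=
  range (fun g => a g x).

Definition property_FM (R : realType) (G : groupType) : Prop :=
  forall (X : Type) (a : leftAction G X),
    (exists m : mean R X, invariant_mean a m) ->
    exists x : X, finite_set (action_orbit a x).

Definition bounded_displacement (s : int -> int) : Prop :=
  exists C : int, forall k : int, `|s k - k| <= C.

Definition factors_through_finite_group (G : groupType) (X : Type)
    (a : leftAction G X) : Prop :=
  exists (F : finGroupType) (f : UMagmaMorphism.type G F)
         (b : leftAction F X),
    forall g x, a g x = b (f g) x.

(* Main.v *)
From HB Require Import structures.
Require Import Defs.
From mathcomp Require Import all_boot all_order all_algebra fingroup.
From mathcomp Require Import all_classical all_reals.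
From mathcomp Require Import topology normedtype.
From mathcomp Require Import zify.
Set Implicit Arguments.
Unset Strict Implicit.
Unset Printing Implicit Defensive.
Import Order.TTheory GRing.Theory Num.Theory.
Import numFieldNormedType.Exports.

Local Open Scope classical_set_scope.
Local Open Scope ring_scope.

(** The theorem splits into two statements about an action of [G] on the
    integers by permutations of bounded displacement.

    Uniformity: under Property FM or FW one constant bounds the displacement of
    all the elements of [G] at once.  Otherwise there are orbits joining points
    arbitrarily far apart; translate them towards the origin and take the limit
    of the translated actions along a nonprincipal ultrafilter.  Since each
    element of [G] has bounded displacement, the limit is again an action by
    permutations of bounded displacement ([recentred_limit_action]), and on any
    finite window the generators act in the limit as they do in infinitely many
    of the translated actions.  Hence a subset of the integers that is invariant
    in the limit and constant near each of the two ends is invariant for some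
    translated action as well ([invariant_set_transfer]); it remains to find
    such a subset that separates two points of the chosen long orbits.

    - With Property FW: bounded displacement makes the negative half-line
      commensurated, so an invariant subset differs from it by a finite set.
      This subset cannot be preserved by an action with an orbit that joins the
      far left to the far right.
    - With Property FM: an infinite orbit carries an invariant mean, the
      ultralimit of the densities along the intervals [-n, n], because a bounded
      displacement changes counts in these intervals by a bounded amount.  As
      [G] is transitive on the orbit, Property FM forbids this, so all orbits
      are finite.  The orbit of the origin in the limit is then an invariant finite
      set, which an action moving the origin far away cannot preserve.

    Finiteness: when all displacements are at most [D], the way in which any
    group element moves a point is determined by the way in which the generators
    move the points at distance at most [D] from it, for which there are
    finitely many possibilities.  So [G] acts through finitely many permutations
    ([uniform_displacement_finite]). *)

(** * Actions, and sets invariant under generators *)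

Lemma actK (G : groupType) (X : Type) (a : leftAction G X) (g : G) :
  cancel (a g) (a g^-1%g).
Proof. by move=> x; rewrite -actM mulVg act1. Qed.

Lemma actVK (G : groupType) (X : Type) (a : leftAction G X) (g : G) :
  cancel (a g^-1%g) (a g).
Proof. by move=> x; rewrite -actM mulgV act1. Qed.

Lemma finitely_generated_invariant (G : groupType) (X : Type)
    (a : leftAction G X) (s : seq G)
    (sG : forall S : {pred G},
      group_closed S -> {subset s <= S} -> forall g, g \in S)
    (P : X -> Prop) :
  (forall g, g \in s -> forall x, P x <-> P (a g x)) ->
  forall g x, P x <-> P (a g x).
Proof.
move=> sP g.
pose S : {pred G} := [pred g | `[< forall x, P x <-> P (a g x) >]].
suff /asboolP : g \in S by [].
apply: sG => [|h hs]; last exact/asboolP/sP.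
split; first by apply/asboolP => x; rewrite act1.
move=> h k /asboolP Ph /asboolP Pk; apply/asboolP => x.
by rewrite actM -Ph (Pk (a _ x)) actVK.
Qed.

(** * Finite sets of integers *)

Definition window (n : nat) : seq int :=
  [seq i%:Z - n%:Z | i <- iota 0 n.*2.+1].

Lemma mem_window (n : nat) (k : int) : (k \in window n) = (`|k| <= n%:Z).
Proof.
apply/mapP/idP => [[i]|kn]; first by rewrite mem_iota; lia.
by exists (absz (k + n%:Z)); [rewrite mem_iota; lia|lia].
Qed.

Lemma finite_int_setP (A : set int) :
  finite_set A <-> exists L : nat, forall k, A k -> `|k| <= L%:Z.
Proof.
split=> [/finite_seqP[s ->]|[L AL]].
  exists (\max_(k <- s) `|k|)%N => k /= ks.
  by rewrite -abszE lez_nat; exact: (@leq_bigmax_seq _ _ xpredT absz).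
apply: (@sub_finite_set _ _ [set` window L]); last exact: finite_seq.
by move=> k /AL kL; rewrite /= mem_window.
Qed.

Lemma bounded_displacement_nat (s : int -> int) :
  bounded_displacement s -> exists C : nat, forall k, `|s k - k| <= C%:Z.
Proof. by case=> C sC; exists `|C|%N => k; have := sC k; lia. Qed.

(** * Recentring an action and passing to the limit *)

(** Outside [-L, L] such a set looks like the empty set, a half-line or
    everything, so a bounded move of a point far out does not affect membership
    in it. *)
Definition constant_at_ends (L : nat) (P : int -> Prop) : Prop :=
  forall j k : int, L%:Z < `|j| -> L%:Z < `|k| -> (j < 0) = (k < 0) ->
  P j <-> P k.

(** An ultrafilter that contains a finite union contains one of its members. *)
Lemma ultrafilter_constant (T : Type) (U : set_system T)
    (UU : UltraFilter U) (f : T -> int) (A : set int) :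
  finite_set A -> U (f @^-1` A) -> exists j, U [set t | f t = j].
Proof.
move=> /finite_seqP[s ->]; elim: s => [|i s IHs] Us.
  by have /filter_ex[t] := Us.
have [Ui|Ui] := in_ultra_setVsetC [set t | f t = i] UU; first by exists i.
apply: IHs; apply: filterS2 Us Ui => t /=.
by rewrite inE => /orP[/eqP|].
Qed.

Lemma filter_forall_seq (T : Type) (I : eqType) (U : set_system T)
    (FU : Filter U) (s : seq I) (P : I -> set T) :
  (forall i, i \in s -> U (P i)) -> U [set t | forall i, i \in s -> P i t].
Proof.
elim: s => [_|i s IHs sP]; first exact: filterE.
apply: filterS2 (sP i (mem_head _ _)) (IHs _) => [t Pi Ps j|j js].
  by rewrite inE => /orP[/eqP->//|]; exact: Ps.
by apply: sP; rewrite inE js orbT.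
Qed.

(** For fixed [g] and [k] the integers [a g (c n + k) - c n] lie in a finite set,
    hence are constant on a set of the ultrafilter; that constant is the image of
    [k] under [g] in the limit.  The action laws and the displacement bounds
    involve finitely many such constants at a time, so they pass to the limit. *)
Lemma recentred_limit_action (G : groupType) (a : leftAction G int)
    (a_bd : forall g, bounded_displacement (a g)) (U : set_system nat)
    (UU : UltraFilter U) (c : nat -> int) :
  exists b : leftAction G int,
    (forall g, bounded_displacement (b g)) /\
    (forall g k, U [set n | a g (c n + k) = c n + b g k]).
Proof.
have FU : Filter U by exact: filter_filter.
have /choice[b bP] : forall p : G * int, exists j,
    U [set n | a p.1 (c n + p.2) = c n + j].
  move=> [g k] /=; have [C aC] := bounded_displacement_nat (a_bd g).
  have [||j Uj] := @ultrafilter_constant _ _ UU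
      (fun n => a g (c n + k) - c n) [set i | `|i - k| <= C%:Z].
  - by apply/finite_int_setP; exists (C + `|k|)%N => i /=; lia.
  - by apply: filterE => n /=; have := aC (c n + k); lia.
  by exists j; apply: filterS Uj => n /=; lia.
have b1 x : b (1%g, x) = x.
  by have /filter_ex[n /=] := bP (1%g, x); rewrite act1 => /addrI.
have bM g h x : b ((g * h)%g, x) = b (g, b (h, x)).
  have /filter_ex[n [/= E [Eg Eh]]] := @filterI _ _ FU _ _ (bP ((g * h)%g, x))
    (@filterI _ _ FU _ _ (bP (g, b (h, x))) (bP (h, x))).
  by move: E; rewrite actM Eh Eg => /addrI.
exists (@LeftAction G int (fun g k => b (g, k)) b1 bM).
split=> [g|g k]; last exact: (bP (g, k)).
have [C aC] := a_bd g; exists C => k /=.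
have /filter_ex[n /= E] := bP (g, k).
by have := aC (c n + k); rewrite E; lia.
Qed.

(** Only the generators matter for invariance.  On the window of radius [L + C],
    where [C] bounds their displacements, they move points in the limit as they
    do in the recentred action for suitable [n]; farther out they cannot carry a
    point from one end to the other, nor into [-L, L], where [P] may vary. *)
Lemma invariant_set_transfer (G : groupType) (G_fg : finitely_generated G)
    (a : leftAction G int) (a_bd : forall g, bounded_displacement (a g))
    (c : nat -> int) :
  exists b : leftAction G int, (forall g, bounded_displacement (b g)) /\
    forall (P : int -> Prop) (L : nat),
      (forall g k, P k <-> P (b g k)) -> constant_at_ends L P ->
      exists2 n : nat, (L <= n)%N &
        forall g x, P (x - c n) <-> P (a g x - c n).
Proof.
have [s sG] := G_fg.
(* An ultrafilter finer than the cofinite one, so that [n] may be taken large. *)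
have [U [UU Uoo]] := @ultraFilterLemma nat \oo _.
have FU : Filter U by exact: filter_filter.
have [b [b_bd bU]] := recentred_limit_action a_bd UU c.
exists b; split=> // P L bP PL.
have [C aC] : exists C : nat, forall g, g \in s ->
    forall k, `|a g k - k| <= C%:Z.
  have /choice[C aC] g := bounded_displacement_nat (a_bd g).
  exists (\max_(g <- s) C g)%N => g gs k; apply: le_trans (aC g k) _.
  by rewrite lez_nat; exact: leq_bigmax_seq.
have /finite_seqP[w wE] : finite_set [set k : int | `|k| <= (L + C)%:Z].
  by apply/finite_int_setP; exists (L + C)%N.
have Uagree : U [set n | forall g, g \in s -> forall k, k \in w ->
    a g (c n + k) = c n + b g k].
  apply: filter_forall_seq => g gs.
  by apply: filter_forall_seq => k kw; exact: bU.
have UL : U [set n | (L <= n)%N] by apply: Uoo; exact: nbhs_infty_ge.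
have /filter_ex[n [/= agree Ln]] := @filterI _ _ FU _ _ Uagree UL.
exists n => //.
apply: (@finitely_generated_invariant _ _ a s sG (fun x => P (x - c n))).
move=> g gs x; have Cx := aC g gs x.
have [kw|kw] := leP `|x - c n| (L + C)%:Z.
  have /(agree g gs) : x - c n \in w.
    by have : [set` w] (x - c n) by rewrite -wE.
  by rewrite addrC subrK => ->; rewrite addrAC subrr add0r.
by apply: PL; lia.
Qed.

(** * Means on infinite sets of integers *)

Lemma window_uniq (n : nat) : uniq (window n).
Proof. by rewrite map_inj_uniq ?iota_uniq // => i j; lia. Qed.

Definition window_count (B : set int) (n : nat) : nat :=
  count (fun k => `[< B k >]) (window n).

Lemma window_countU (A B : set int) (n : nat) : A `&` B = set0 ->
  window_count (A `|` B) n = (window_count A n + window_count B n)%N.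
Proof.
move=> AB; rewrite /window_count -count_predUI [X in (_ + X)%N](_ : _ = 0%N).
  by rewrite addn0; apply: eq_count => k /=; rewrite asbool_or.
apply/eqP; rewrite -leqn0 leqNgt -has_count; apply/hasPn => k _ /=.
apply/negP => /andP[/asboolP Ak /asboolP Bk].
by have : (A `&` B) k by []; rewrite AB.
Qed.

(** Widening adds [C] integers on each side of the window. *)
Lemma window_count_widen (B : set int) (n C : nat) :
  (window_count B (n + C) <= window_count B n + C.*2)%N.
Proof.
have -> : window_count B (n + C) = count (fun k => `[< B k >])
    ([seq i%:Z - (n + C)%:Z | i <- iota 0 C] ++ window n ++
     [seq i%:Z - (n + C)%:Z | i <- iota (C + n.*2.+1) C]).
  rewrite /window_count /window.
  have -> : [seq i%:Z - n%:Z | i <- iota 0 n.*2.+1] =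
      [seq i%:Z - (n + C)%:Z | i <- iota C n.*2.+1].
    have -> : iota C n.*2.+1 = [seq (C + i)%N | i <- iota 0 n.*2.+1].
      by rewrite -iotaDl addn0.
    by rewrite -map_comp; apply: eq_map => i; rewrite [RHS]/=; lia.
  rewrite -!map_cat catA -iotaD.
  have -> : (n + C).*2.+1 = (C + n.*2.+1 + C)%N by lia.
  by rewrite [in LHS]iotaD.
rewrite !count_cat addnCA leq_add2l -[C.*2]addnn.
by apply: leq_add; apply: leq_trans (count_size _ _) _;
  rewrite size_map size_iota.
Qed.

Lemma window_count_shift (A B : set int) (f : int -> int) (C n : nat) :
  (forall k, A k -> B (f k) /\ `|f k - k| <= C%:Z) ->
  (forall j k, A j -> A k -> f j = f k -> j = k) ->
  (window_count A n <= window_count B n + C.*2)%N.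
Proof.
move=> fAB f_inj; apply: leq_trans (window_count_widen B n C).
rewrite /window_count -!size_filter -(size_map f); apply: uniq_leq_size.
  rewrite map_inj_in_uniq ?filter_uniq ?window_uniq // => j k.
  rewrite !mem_filter => /andP[/asboolP Aj _] /andP[/asboolP Ak _].
  exact: f_inj.
move=> _ /mapP[k + ->]; rewrite !mem_filter => /andP[/asboolP Ak].
have [Bk fk] := fAB k Ak.
by rewrite !mem_window => kn; apply/andP; split; [exact/asboolP|lia].
Qed.

Lemma window_count_infinite (B : set int) (K : nat) : infinite_set B ->
  exists N, forall n, (N <= n)%N -> (K <= window_count B n)%N.
Proof.
move=> /(infinite_set_fset K)[F FB KF].
have /finite_int_setP[N FN] := finite_fset F.
exists N => n Nn; apply: leq_trans KF _.
rewrite /window_count -size_filter; apply: uniq_leq_size => // k kF.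
by rewrite mem_filter mem_window; apply/andP; split;
  [exact/asboolP/FB|have := FN k kF; lia].
Qed.

(** The image of an ultrafilter is an ultrafilter, and ultrafilters on a compact
    set converge. *)
Lemma ultralimit_exists (R : realType) (U : set_system nat)
    (UU : UltraFilter U) (u : nat -> R) :
  (forall n, 0 <= u n <= 1) -> exists l : R, u n @[n --> U] --> l.
Proof.
move=> u01.
have : compact (`[0, 1]%classic : set R) by exact: segment_compact.
rewrite compact_ultra => /(_ (u @ U)) [||l [_ ul]]; last by exists l.
  split=> [|F FF uF]; first exact: fmap_proper_filter.
  apply/seteqP; split=> // A FA.
  have [//|UA] := in_ultra_setVsetC (u @^-1` A) UU.
  have /uF FCA : (u @ U) (~` A) by [].
  by have /filter_ex[? []] := @filterI _ _ (@filter_filter _ _ FF) _ _ FA FCA.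
have /= := @filterE _ U _ (u @^-1` `[0, 1]); apply => n.
by rewrite /= in_itv /= u01.
Qed.

Lemma ratio01 (R : realType) (k d : nat) : (k <= d)%N ->
  0 <= (k%:R / d%:R : R) <= 1.
Proof.
case: d => [|d] kd; first by rewrite invr0 mulr0 lexx ler01.
by rewrite divr_ge0 //= ler_pdivrMr ?ltr0n // mul1r ler_nat.
Qed.

(** The centred windows form a Folner sequence for every group that moves the
    points of an infinite set of integers by bounded displacements: moving a set
    changes its count in a window by a bounded number, whereas the number of
    points of the whole set in the window tends to infinity.  Thus the ultralimit
    of densities relative to the whole set is invariant.  The set is given by an
    injection [v], to apply directly to an orbit viewed as a type. *)
Lemma bounded_displacement_mean (R : realType) (G : groupType) (X : Type)
    (a : leftAction G X) (v : X -> int) (v_inj : injective v)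
    (v_inf : infinite_set (range v))
    (a_bd : forall g, exists C : nat, forall x, `|v (a g x) - v x| <= C%:Z) :
  exists m : mean R X, invariant_mean a m.
Proof.
have [U [UU Uoo]] := @ultraFilterLemma nat \oo _.
have FU : ProperFilter U by exact: ultra_proper.
pose d n := window_count (range v) n.
pose u (A : set X) n : R := (window_count (v @` A) n)%:R / (d n)%:R.
have u01 A n : 0 <= u A n <= 1.
  apply/ratio01/sub_count => k /asboolP[x Ax xk].
  by apply/asboolP; exists x.
have /choice[m um] : forall A, exists l : R, u A n @[n --> U] --> l.
  by move=> A; exact: ultralimit_exists.
have mE A l : u A n @[n --> U] --> l -> m A = l.
  by move=> ul; exact: (cvg_unique _ (um A) ul).
have d_ge K : \forall n \near U, (K <= d n)%N.
  apply: Uoo; have [N dN] := window_count_infinite K v_inf.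
  by exists N.
have m_ge0 A : 0 <= m A.
  apply: (closed_cvg _ (@closed_ge _ 0) _ _ (um A)).
  by apply: filterE => n; have /andP[] := u01 A n.
have m_setT : m setT = 1.
  apply/mE; apply: cvg_near_cst.
  apply: filterS (d_ge 1%N) => n dn.
  by rewrite /u divff // pnatr_eq0 -lt0n.
have m_setU A B : A `&` B = set0 -> m (A `|` B) = m A + m B.
  move=> AB; apply: mE.
  suff -> : u (A `|` B) = u A \+ u B by exact: cvgD (um A) (um B).
  apply/funext => n; rewrite /u image_setU window_countU.
    by rewrite natrD mulrDl.
  apply/seteqP; split=> // z [[x Ax <-] [y By /v_inj yx]].
  by have : (A `&` B) x; [split=> //; rewrite -yx|rewrite AB].
have mgA_le g A : m (a g @` A) <= m A.
  have [C aC] := a_bd g.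
  have u_le n : u (a g @` A) n <= u A n + C.*2%:R / (d n)%:R.
    rewrite /u -mulrDl -natrD ler_wpM2r ?invr_ge0 // ler_nat.
    (* [f] undoes the action of [g] on the integers that represent [a g @` A]. *)
    have /choice[f fP] : forall k, exists j : int, (v @` (a g @` A)) k ->
        exists2 x, A x & v x = j /\ v (a g x) = k.
      move=> k; have [[_ [x Ax <-] <-]|nk] := pselect ((v @` (a g @` A)) k).
        by exists (v x) => _; exists x.
      by exists 0.
    apply: (@window_count_shift _ _ f) => [k|j k].
      move=> /fP[x Ax [<- <-]]; split; first by exists x.
      by rewrite distrC.
    move=> /fP[x Ax [<- <-]] /fP[y Ay [<- <-]] /v_inj -> //.
  apply/ler_addgt0Pr => e e0.
  apply: (ler_cvg_to (um (a g @` A)) (cvgD (um A) (cvg_cst e))).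
  apply: filterS (d_ge (Num.bound (C.*2%:R / e)).+1) => n dn /=.
  apply: le_trans (u_le n) _; rewrite lerD2l.
  have d0 : (0 : R) < (d n)%:R by rewrite ltr0n; apply: leq_trans dn.
  rewrite ler_pdivrMr // mulrC -ler_pdivrMr //.
  apply: le_trans (ltW (archi_boundP _)) _; first by rewrite divr_ge0 // ltW.
  by rewrite ler_nat ltnW.
exists (Mean m_ge0 m_setT m_setU) => g A /=; apply/eqP; rewrite eq_le mgA_le /=.
have {1}-> : A = a g^-1%g @` (a g @` A).
  by rewrite image_comp (_ : _ \o _ = id) ?image_id //; apply/funext/actK.
exact: mgA_le.
Qed.

(** * Uniform displacement from Property FW or FM *)

(** The points far apart in one orbit are placed symmetrically about the centre,
    one on each side, at distance more than [n]. *)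
Lemma uniform_displacement_FW (G : groupType) (G_fg : finitely_generated G)
    (G_FW : property_FW G) (a : leftAction G int)
    (a_bd : forall g, bounded_displacement (a g)) :
  exists D : nat, forall g x, `|a g x - x| <= D%:Z.
Proof.
apply: contrapT => noD.
have /choice[p pP] : forall n : nat, exists p : G * int,
    (n.*2.+2)%:Z < `|a p.1 p.2 - p.2|.
  move=> n; apply: contrapT => nop; apply: noD; exists n.*2.+2 => g x.
  by rewrite leNgt; apply/negP => gx; apply: nop; exists (g, x).
pose x n := (p n).2; pose y n := a (p n).1 (x n).
have [b [b_bd transfer]] := invariant_set_transfer G_fg a_bd
  (fun n => Num.min (x n) (y n) + n.+1%:Z).
have /G_FW[N [Ninv /finite_int_setP[L NL]]] :
    commensurated b [set k : int | k < 0].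
  move=> g; apply/finite_int_setP.
  have [C bC] := bounded_displacement_nat (b_bd g^-1%g).
  exists C => k [] /= [].
    move=> k0 nk; have := bC k; case: (ltP (b g^-1%g k) 0) => [gk|]; last lia.
    by case: nk; exists (b g^-1%g k) => //; rewrite actVK.
  by move=> [i /= i0 <-] /negP ?; have := bC (b g i); rewrite actK; lia.
(* Beyond [L] the invariant set [N] coincides with the negative half-line. *)
have NE k : L%:Z < `|k| -> N k <-> k < 0.
  move=> Lk; split=> kN; apply: contrapT => nkN.
    by have := NL k (or_intror (conj kN nkN)); lia.
  by have := NL k (or_introl (conj kN nkN)); lia.
have [||n Ln nP] := transfer N L.
- move=> g k; split=> [Nk|]; first by rewrite -(Ninv g); exists k.
  by rewrite -{1}(Ninv g) => -[i Ni] /(can_inj (actK b g)) <-.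
- by move=> j k Lj Lk jk; rewrite NE // NE // jk.
have := nP (p n).1 (x n); rewrite -/(y n); have := pP n.
rewrite -/(x n) -/(y n) => xy.
by rewrite NE ?NE; lia.
Qed.

(** [G] is transitive on an orbit, so the finite orbit that Property FM provides
    there is the whole of it. *)
Lemma finite_orbits_FM (R : realType) (G : groupType)
    (G_FM : property_FM R G) (a : leftAction G int)
    (a_bd : forall g, bounded_displacement (a g)) (x : int) :
  finite_set (action_orbit a x).
Proof.
apply: contrapT => Oinf.
pose X := {y : int | `[< action_orbit a x y >]}.
have aX g (y : X) : `[< action_orbit a x (a g (val y)) >].
  have /asboolP[h _ hy] := valP y.
  by apply/asboolP; exists (g * h)%g; rewrite // actM hy.
pose b_act g (y : X) : X := exist _ (a g (val y)) (aX g y).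
have b_act1 y : b_act 1%g y = y by apply: val_inj; exact: act1.
have b_actM g h y : b_act (g * h)%g y = b_act g (b_act h y).
  by apply: val_inj; exact: actM.
pose b := LeftAction b_act1 b_actM.
have rangeX : range (val : X -> int) = action_orbit a x.
  apply/seteqP; split=> [_ [y _ <-]|y Oy]; first exact/asboolP/(valP y).
  by exists (exist _ y (asboolT Oy)).
have [|y] := G_FM X b.
  apply: (@bounded_displacement_mean _ _ _ b val).
  - exact: val_inj.
  - by rewrite rangeX.
  - move=> g; have [C aC] := bounded_displacement_nat (a_bd g).
    by exists C => y; exact: aC.
have /asboolP[h _ hy] := valP y.
move=> /(finite_image val); apply: contra_not Oinf; apply: sub_finite_set.
move=> _ [g _ <-]; exists (b (g * h^-1)%g y); first by exists (g * h^-1)%g.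
by rewrite /= -hy -actM mulgKV.
Qed.

Lemma uniform_displacement_FM (R : realType) (G : groupType)
    (G_fg : finitely_generated G) (G_FM : property_FM R G)
    (a : leftAction G int) (a_bd : forall g, bounded_displacement (a g)) :
  exists D : nat, forall g x, `|a g x - x| <= D%:Z.
Proof.
apply: contrapT => noD.
have /choice[p pP] : forall n : nat, exists p : G * int,
    n%:Z < `|a p.1 p.2 - p.2|.
  move=> n; apply: contrapT => nop; apply: noD; exists n => g x.
  by rewrite leNgt; apply/negP => gx; apply: nop; exists (g, x).
have [b [b_bd transfer]] := invariant_set_transfer G_fg a_bd (fun n => (p n).2).
have /finite_int_setP[L OL] := finite_orbits_FM G_FM b_bd 0.
have [||n Ln nO] := transfer (action_orbit b 0) L.
- move=> g k; split=> [[h _ <-]|[h _ hk]].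
    by exists (g * h)%g; rewrite // actM.
  by exists (g^-1 * h)%g; rewrite // actM hk actK.
- by move=> j k Lj Lk _; split=> /OL; lia.
have : action_orbit b 0 (a (p n).1 (p n).2 - (p n).2).
  by apply/(nO _ _).1; exists 1%g; rewrite // act1 /= subrr.
by move=> /OL; have := pP n; lia.
Qed.

(** * From uniform displacement to a finite group *)

(** The values of [phi] label the permutations by which [G] acts, so finitely
    many occur.  The group law is transported to the labels by choosing for each
    of them an element [r t] of [G]; the labels of products and inverses do not
    depend on this choice. *)
Lemma finite_group_image (G : groupType) (X : Type) (a : leftAction G X)
    (T : finType) (phi : G -> T) :
  (forall g h, phi g = phi h -> a g =1 a h) ->
  (forall g h, a g =1 a h -> phi g = phi h) ->
  factors_through_finite_group a.
Proof.
move=> phi_a a_phi.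
pose I := {t : T | `[< exists g, phi g = t >]}.
pose cl g : I := exist _ (phi g) (asboolT (ex_intro _ g erefl)).
have clP g h : cl g = cl h <-> a g =1 a h.
  by split=> [[/phi_a]|/a_phi gh] //; apply: val_inj.
have /choice[r rK] : forall t : I, exists g, cl g = t.
  by case=> t pt; have /asboolP[g gt] := pt; exists g; apply: val_inj.
have ar g : a (r (cl g)) =1 a g by apply/clP; rewrite rK.
have clM g h : cl (r (cl g) * r (cl h))%g = cl (g * h)%g.
  by apply/clP => x; rewrite !actM !ar.
have cl_ind (P : I -> Prop) : (forall g, P (cl g)) -> forall t, P t.
  by move=> Pcl t; rewrite -(rK t).
pose mul (t u : I) := cl (r t * r u)%g.
have mulE g h : mul (cl g) (cl h) = cl (g * h)%g by exact: clM.
pose inv (t : I) := cl (r t)^-1%g.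
have invE g : inv (cl g) = cl g^-1%g.
  by apply/clP => x; rewrite -{1}(actVK a g x) -(ar g) actK.
have mulA : associative mul.
  apply: (cl_ind _ _) => g; apply: (cl_ind _ _) => h; apply: (cl_ind _ _) => k.
  by rewrite !mulE mulgA.
have mul1 : left_id (cl 1%g) mul.
  by apply: (cl_ind _ _) => g; rewrite mulE mul1g.
have mulV : left_inverse (cl 1%g) inv mul.
  by apply: (cl_ind _ _) => g; rewrite invE mulE mulVg.
pose F : finGroupType :=
  HB.pack I (Finite_isGroup.Build I mulA mul1 mulV).
have fM : {morph (cl : G -> F) : g h / (g * h)%g >-> (g * h)%g}.
  by move=> g h; rewrite -mulE.
have f1 : (cl : G -> F) 1%g = 1%g by [].
pose f : UMagmaMorphism.type G F := HB.pack (cl : G -> F)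
  (isMultiplicative.Build G F cl fM)
  (Multiplicative_isUMagmaMorphism.Build G F cl f1).
have b1 x : a (r (1%g : F)) x = x by rewrite ar act1.
have bM (t u : F) x : a (r (t * u)%g) x = a (r t) (a (r u) x).
  by rewrite ar actM.
exists F, f, (@LeftAction F X (fun t => a (r t)) b1 bM) => g x.
by rewrite /= ar.
Qed.

(** The pattern [tau x] records how the generators move the points at distance at
    most [D] from [x].  If [tau x = tau y] then every [g] displaces [x] and [y]
    equally: along any word in the generators, the images of [x] and of [y] keep
    equal offsets, and these offsets never exceed [D].  So the displacements at
    one representative of each pattern determine the permutation given by [g]. *)
Lemma uniform_displacement_finite (G : groupType)
    (G_fg : finitely_generated G) (a : leftAction G int) (D : nat)
    (aD : forall g x, `|a g x - x| <= D%:Z) :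
  factors_through_finite_group a.
Proof.
have [s sG] := G_fg.
pose enc (k : int) : 'I_D.*2.+1 := inord (absz (k + D%:Z)).
have enc_inj g h x y : enc (a g x - x) = enc (a h y - y) ->
    a g x - x = a h y - y.
  move=> /(congr1 val); have := aD g x; have := aD h y.
  by rewrite /enc /= => ? ?; rewrite !inordK; lia.
pose tau (x : int) := [ffun p : 'I_(size s) * 'I_D.*2.+1 =>
  let z := x + (p.2%:Z - D%:Z) in enc (a (nth 1%g s p.1) z - z)].
have tauP g x y j : g \in s -> tau x = tau y -> `|j| <= D%:Z ->
    a g (x + j) - (x + j) = a g (y + j) - (y + j).
  move=> gs xy jD; have is_ : (index g s < size s)%N by rewrite index_mem.
  pose i := inord (absz (j + D%:Z)) : 'I_D.*2.+1.
  have iE : i%:Z - D%:Z = j by rewrite /i inordK; lia.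
  have /ffunP/(_ (Ordinal is_, i)) := xy.
  by rewrite !ffunE /= iE nth_index // => /enc_inj.
have tau_disp g x y : tau x = tau y -> a g x - x = a g y - y.
  move=> xy.
  (* Words may contain inverses of generators, so [E] has to be invariant,
     rather than only stable, under left multiplication by each generator. *)
  pose E h := a h x - x = a h y - y.
  pose lmul : leftAction G G :=
    LeftAction (act := fun h k : G => (h * k)%g) (@mul1g G)
      (fun h k l => esym (mulgA h k l)).
  suff /(_ g 1%g) : forall h k, E k <-> E (lmul h k).
    by rewrite /lmul /= mulg1 => -[+ _]; apply; rewrite /E !act1 !subrr.
  apply: (finitely_generated_invariant sG) => k ks h; rewrite /E /= !actM.
  have xyK z w : z + (w - z) = w :> int by rewrite addrC subrK.
  have := tauP k x y _ ks xy (aD h x); rewrite xyK => kh.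
  split=> Eh; first by move: kh; rewrite Eh xyK; lia.
  have /(can_inj (actK a k)) : a k (y + (a h x - x)) = a k (a h y) by lia.
  by lia.
pose rep t := xget 0 [set x | tau x = t].
have tau_rep x : tau (rep (tau x)) = tau x.
  by apply: (@xgetPex _ 0 [set z | tau z = tau x]); exists x.
apply: (@finite_group_image _ _ a _ (fun g =>
    [ffun t => enc (a g (rep t) - rep t)])) => g h.
  move=> /ffunP gh x; have := gh (tau x); rewrite !ffunE => /enc_inj.
  by rewrite !(tau_disp _ _ _ (tau_rep x)); lia.
by move=> gh; apply/ffunP => t; rewrite !ffunE gh.
Qed.

Theorem theorem1p18 (R : realType) (G : groupType)
    (G_fg : finitely_generated G)
    (G_FM_or_FW : property_FM R G \/ property_FW G)
    (a : leftAction G int)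
    (a_bd : forall g : G, bounded_displacement (a g)) :
  factors_through_finite_group a.
Proof.
have [D aD] : exists D : nat, forall g x, `|a g x - x| <= D%:Z.
  case: G_FM_or_FW => [G_FM|G_FW].
    exact: uniform_displacement_FM G_FM _ _.
  exact: uniform_displacement_FW.
exact: uniform_displacement_finite aD.
Qed.
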